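(* Let $U_1,U_2,U_3,V_1,V_2,V_3$ be finite-dimensional complex vector spaces, let $T \in U_1 \otimes U_2 \otimes U_3$ and $S \in V_1 \otimes V_2 \otimes V_3$, and assume that $T$ partially degenerates to $S$ with approximation degree $d$ and error degree $e$. Then $T^{\blacksquare (d+1)}$ restricts to $S$ and $T^{\blacksquare (e+1)}$ restricts to $S$.
   Context: For tensors $T \in U_1 \otimes U_2 \otimes U_3$ and $S \in V_1\otimes V_2\otimes V_3$: - $T$ restricts to $S$ if there are linear maps $A_i: U_i\to V_i$ ($i=1,2,3$) with $S=(A_1\otimes A_2\otimes A_3)T$. - $T$ partially degenerates to $S$ with approximation degree $d$ and error degree $e$ (natural numbers $\geq 0$) if there are a linear map $A_1:U_1\to V_1$ (constant), linear maps $A_2(\epsilon):U_2\to V_2$, $A_3(\epsilon):U_3\to V_3$ with entries in $\mathbb{C}[\epsilon]$, and tensors $S_1,\dots,S_e \in V_1\otimes V_2\otimes V_3$ such that $(A_1\otimes A_2(\epsilon)\otimes A_3(\epsilon))T=\epsilon^d S+\epsilon^{d+1}S_1+\dots+\epsilon^{d+e}S_e$. For $p\ge 1$, $T^{\blacksquare p} = T\boxtimes\langle 1,1,p\rangle\in U_1\otimes(U_2\otimes\mathbb{C}^p)\otimes(U_3\otimes\mathbb{C}^p)$, where $\boxtimes$ is the Kronecker product and $\langle 1,1,p\rangle = e_1\otimes\sum_{l=1}^p e_l\otimes e_l \in \mathbb{C}^1\otimes\mathbb{C}^p\otimes\mathbb{C}^p$. Explicitly, if $T=\sum T_{ijk}\,e_i\otimes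 e_j\otimes e_k$ in bases, then $T^{\blacksquare p}=\sum_{i,j,k}\sum_{l=1}^p T_{ijk}\, e_i\otimes(e_j\otimes e_l)\otimes(e_k\otimes e_l)$. *)

(* Defs.v *)
From HB Require Import structures.
From mathcomp Require Import all_boot all_order all_algebra.
From mathcomp Require Import complex reals.

Set Implicit Arguments.
Unset Strict Implicit.
Unset Printing Implicit Defensive.

Import GRing.Theory VectorInternalTheory.
Local Open Scope ring_scope.

(* Every vectType U carries a reference basis, the image under r2v of the
   canonical basis of 'rV_(dim U).  An element of U1 (x) U2 (x) U3 is represented
   by its array of coordinates in the tensor products of the reference basis
   vectors.  F^o is F seen as a vector space over itself.  The section
   PureTensors checks that pure tensors are trilinear and span, and that
   tensor_map and blacksquare are given on them by the usual basis-free
   formulas. *)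

Notation hypermx K n1 n2 n3 := {ffun 'I_n1 * 'I_n2 * 'I_n3 -> K}.

Definition tensor (F : fieldType) (U1 U2 U3 : vectType F) : Type :=
  hypermx F^o (dim U1) (dim U2) (dim U3).

HB.instance Definition _ (F : fieldType) (U1 U2 U3 : vectType F) :=
  Vector.copy (tensor U1 U2 U3) (hypermx F^o (dim U1) (dim U2) (dim U3)).

Definition ebasis (F : fieldType) (U : vectType F) (i : 'I_(dim U)) : U :=
  r2v (delta_mx 0 i).

Definition pure (F : fieldType) (U1 U2 U3 : vectType F)
    (u1 : U1) (u2 : U2) (u3 : U3) : tensor U1 U2 U3 :=
  [ffun i => v2r u1 0 i.1.1 * v2r u2 0 i.1.2 * v2r u3 0 i.2].

(* Matrices act on row vectors, so row indices belong to the source.  The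
   coefficient ring is arbitrary because this is used over F and over F[eps]. *)
Definition hypermx_act (K : comNzRingType) (m1 m2 m3 n1 n2 n3 : nat)
    (A1 : 'M[K]_(m1, n1)) (A2 : 'M[K]_(m2, n2)) (A3 : 'M[K]_(m3, n3))
    (T : hypermx K m1 m2 m3) : hypermx K n1 n2 n3 :=
  [ffun j => \sum_i A1 i.1.1 j.1.1 * A2 i.1.2 j.1.2 * A3 i.2 j.2 * T i].

Definition coord_mx (F : fieldType) (U V : vectType F) (A : 'Hom(U, V)) :
    'M[F]_(dim U, dim V) :=
  \matrix_(i, j) v2r (A (ebasis i)) 0 j.

Definition tensor_map (F : fieldType) (U1 U2 U3 V1 V2 V3 : vectType F)
    (A1 : 'Hom(U1, V1)) (A2 : 'Hom(U2, V2)) (A3 : 'Hom(U3, V3))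
    (T : tensor U1 U2 U3) : tensor V1 V2 V3 :=
  hypermx_act (coord_mx A1) (coord_mx A2) (coord_mx A3) T.

Definition restricts (F : fieldType) (U1 U2 U3 V1 V2 V3 : vectType F)
    (T : tensor U1 U2 U3) (S : tensor V1 V2 V3) : Prop :=
  exists (A1 : 'Hom(U1, V1)) (A2 : 'Hom(U2, V2)) (A3 : 'Hom(U3, V3)),
    S = tensor_map A1 A2 A3 T.

(* eps^k T, a tensor with coefficients in F[eps]; the formal variable eps is
   'X. *)
Definition eps_tensor (F : fieldType) (U1 U2 U3 : vectType F) (k : nat)
    (T : tensor U1 U2 U3) : hypermx {poly F} (dim U1) (dim U2) (dim U3) :=
  [ffun i => T i *: 'X^k].

(* d is the approximation degree and e the error degree; the tensor S_(k+1)
   is E k. *)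
Definition partially_degenerates (F : fieldType)
    (U1 U2 U3 V1 V2 V3 : vectType F) (d e : nat)
    (T : tensor U1 U2 U3) (S : tensor V1 V2 V3) : Prop :=
  exists (A1 : 'Hom(U1, V1))
         (A2 : 'M[{poly F}]_(dim U2, dim V2))
         (A3 : 'M[{poly F}]_(dim U3, dim V3))
         (E : 'I_e -> tensor V1 V2 V3),
    hypermx_act (map_mx polyC (coord_mx A1)) A2 A3 (eps_tensor 0 T) =
    eps_tensor d S + \sum_(k < e) eps_tensor (d + k.+1) (E k).

(* U (x) F^p, as matrices: u (x) w is the product of the coordinate column
   of u and the row w. *)
Notation tens_Fp U p := 'M_(dim U, p) (only parsing).

Definition tens_vec (F : fieldType) (U : vectType F) (p : nat)
    (u : U) (w : 'rV[F]_p) : tens_Fp U p := (v2r u)^T *m w.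

(* T [x] <1,1,p>, with U1 (x) F^1 identified with U1. *)
Definition blacksquare (F : fieldType) (U1 U2 U3 : vectType F) (p : nat)
    (T : tensor U1 U2 U3) : tensor U1 (tens_Fp U2 p) (tens_Fp U3 p) :=
  \sum_i \sum_(l < p)
    T i *: pure (ebasis i.1.1) (tens_vec (ebasis i.1.2) (delta_mx 0 l))
                (tens_vec (ebasis i.2) (delta_mx 0 l)).

Section PureTensors.

Variables (F : fieldType) (U1 U2 U3 V1 V2 V3 : vectType F).

Lemma v2r_ebasis (U : vectType F) (i j : 'I_(dim U)) :
  v2r (ebasis i) 0 j = (j == i)%:R.
Proof. by rewrite r2vK mxE eqxx. Qed.

Lemma ebasis_sum (U : vectType F) (u : U) :
  u = \sum_i v2r u 0 i *: ebasis i.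
Proof.
apply: (can_inj v2rK); rewrite linear_sum /= {1}[v2r u]row_sum_delta.
by apply: eq_bigr => i _; rewrite linearZ /= r2vK.
Qed.

Lemma pure_linear1 (u2 : U2) (u3 : U3) :
  linear (fun u1 : U1 => pure u1 u2 u3).
Proof.
move=> a u v; apply/ffunP => i; rewrite !ffunE linearP !mxE.
by rewrite !mulrDl -!mulrA.
Qed.

Lemma pure_linear2 (u1 : U1) (u3 : U3) :
  linear (fun u2 : U2 => pure u1 u2 u3).
Proof.
move=> a u v; apply/ffunP => i; rewrite !ffunE linearP !mxE.
by rewrite mulrDr mulrDl mulrCA -!mulrA.
Qed.

Lemma pure_linear3 (u1 : U1) (u2 : U2) :
  linear (fun u3 : U3 => pure u1 u2 u3).
Proof.
move=> a u v; apply/ffunP => i; rewrite !ffunE linearP !mxE.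
by rewrite mulrDr mulrCA.
Qed.

Lemma tensor_sum_pure (T : tensor U1 U2 U3) :
  T = \sum_i T i *: pure (ebasis i.1.1) (ebasis i.1.2) (ebasis i.2).
Proof.
apply/ffunP => j; rewrite sum_ffunE (bigD1 j) //= big1 ?addr0.
  by rewrite !ffunE !v2r_ebasis !eqxx !mulr1 [RHS]mulr1.
case: j => [[j1 j2] j3] [[i1 i2] i3] /= ne_ij.
rewrite !ffunE /= !v2r_ebasis -!natrM !mulnb.
have -> : (j1 == i1) && (j2 == i2) && (j3 == i3) = false.
  by apply: contraNF ne_ij => /andP[/andP[/eqP-> /eqP->] /eqP->].
exact: mulr0.
Qed.

Lemma v2r_coord_mx (U V : vectType F) (A : 'Hom(U, V)) (u : U) :
  v2r (A u) = v2r u *m coord_mx A.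
Proof.
apply/rowP => j; rewrite [in LHS](ebasis_sum u) !linear_sum summxE !mxE.
by apply: eq_bigr => i _; rewrite !linearZ !mxE.
Qed.

Lemma tensor_map_linear (A1 : 'Hom(U1, V1)) (A2 : 'Hom(U2, V2))
  (A3 : 'Hom(U3, V3)) : linear (tensor_map A1 A2 A3).
Proof.
move=> a T T'; apply/ffunP => j; rewrite !ffunE.
rewrite scaler_sumr -big_split /=; apply: eq_bigr => i _.
by rewrite !ffunE mulrDr mulrCA.
Qed.

Lemma tensor_map_pure (A1 : 'Hom(U1, V1)) (A2 : 'Hom(U2, V2))
    (A3 : 'Hom(U3, V3)) (u1 : U1) (u2 : U2) (u3 : U3) :
  tensor_map A1 A2 A3 (pure u1 u2 u3) = pure (A1 u1) (A2 u2) (A3 u3).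
Proof.
apply/ffunP => -[[j1 j2] j3]; rewrite !ffunE /= !v2r_coord_mx !mxE.
rewrite big_distrlr /= pair_big big_distrlr /= pair_big /=.
apply: eq_bigr => -[[i1 i2] i3] _; rewrite ffunE /=.
by rewrite mulrC mulrACA (mulrACA (v2r u1 0 i1)).
Qed.

Lemma blacksquare_linear p : linear (@blacksquare F U1 U2 U3 p).
Proof.
move=> a T T'; rewrite /blacksquare scaler_sumr -big_split /=.
apply: eq_bigr => i _; rewrite scaler_sumr -big_split /=.
by apply: eq_bigr => l _; rewrite !ffunE scalerDl scalerA.
Qed.

Lemma tens_vec_sum (U : vectType F) p (u : U) (w : 'rV[F]_p) :
  tens_vec u w = \sum_i v2r u 0 i *: tens_vec (ebasis i) w.
Proof.
rewrite /tens_vec [in LHS](ebasis_sum u) !linear_sum mulmx_suml /=.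
by apply: eq_bigr => i _; rewrite !linearZ /= -scalemxAl.
Qed.

Lemma blacksquare_pure p (u1 : U1) (u2 : U2) (u3 : U3) :
  blacksquare p (pure u1 u2 u3) =
  \sum_(l < p) pure u1 (tens_vec u2 (delta_mx 0 l))
                       (tens_vec u3 (delta_mx 0 l)).
Proof.
rewrite /blacksquare exchange_big; apply: eq_bigr => l _ /=.
apply/ffunP => j; rewrite sum_ffunE ffunE.
rewrite [in RHS](ebasis_sum u1) [in RHS]tens_vec_sum.
rewrite [in X in _ = _ * v2r X 0 _]tens_vec_sum !linear_sum !summxE /=.
rewrite big_distrlr /= pair_big big_distrlr /= pair_big /=.
apply: eq_bigr => i _; rewrite !ffunE ![in RHS]linearZ ![in RHS]mxE.
by rewrite (mulrACA (v2r u1 0 _)) [RHS]mulrACA.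
Qed.

End PureTensors.

(* Main.v *)
Require Import Defs.
From HB Require Import structures.
From mathcomp Require Import all_boot all_order all_algebra.
From mathcomp Require Import complex reals.

(** Write the degeneration as
    (A1 (x) A2(eps) (x) A3(eps)) T = eps^d G(eps), where G has degree at most e
    in eps and G(0) = S.  The map A1 is constant, so S can be recovered from the
    left-hand side as a sum over few indices l of terms
    (A1 (x) B2_l (x) B3_l) T that all share the same A1:
    - as the coefficient of eps^d of a product, it is the convolution of the
      d + 1 pairs of coefficients A2_l, A3_(d-l);
    - as the constant term of G, which has e + 1 coefficients, it is a fixed
      linear combination of the values of G at e + 1 distinct points
      (Lagrange interpolation).  At nonzero points, the value of G is that of
      the left-hand side divided by a power of the point, and the scalar can be
      absorbed into B2_l.
    Finally, p terms sharing A1 are exactly what p diagonal copies of T can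
    provide ([restricts_blacksquare]): on the l-th summand of U2 (x) F^p and
    U3 (x) F^p one applies B2_l and B3_l.  A first factor depending on l could
    not be handled in this way, as U1 occurs only once. *)

Set Implicit Arguments.
Unset Strict Implicit.
Unset Printing Implicit Defensive.

Import GRing.Theory Num.Theory VectorInternalTheory.
Local Open Scope ring_scope.

Section MatrixMaps.

Variable F : fieldType.

Definition mx_hom (U V : vectType F) (M : 'M[F]_(dim U, dim V)) : 'Hom(U, V) :=
  linfun (r2v \o mulmxr M \o v2r).

Lemma coord_mx_hom (U V : vectType F) (M : 'M[F]_(dim U, dim V)) :
  coord_mx (mx_hom M) = M.
Proof.
apply/matrixP => i j; rewrite mxE lfunE /= !r2vK.
by rewrite -rowE mxE.
Qed.

(** The map U (x) F^p -> V that is [B l] on the summand U (x) e_l; column l of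
    X holds the coordinates of the component in that summand. *)
Definition slice_sum (U V : vectType F) p (B : 'I_p -> 'Hom(U, V))
    (X : 'M[F]_(dim U, p)) : V :=
  \sum_l B l (r2v (col l X)^T).

Lemma slice_sum_is_linear (U V : vectType F) p (B : 'I_p -> 'Hom(U, V)) :
  linear (slice_sum B).
Proof.
move=> a X Y; rewrite /slice_sum scaler_sumr -big_split /=.
by apply: eq_bigr => l _; rewrite !linearP.
Qed.

HB.instance Definition _ (U V : vectType F) p (B : 'I_p -> 'Hom(U, V)) :=
  GRing.isLinear.Build F 'M[F]_(dim U, p) V _ (slice_sum B)
    (slice_sum_is_linear B).

Lemma slice_sum_tens_vec (U V : vectType F) p (B : 'I_p -> 'Hom(U, V))
    (u : U) l :
  slice_sum B (tens_vec u (delta_mx 0 l)) = B l u.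
Proof.
have colE k : (col k (tens_vec u (delta_mx 0 l)))^T = (k == l)%:R *: v2r u.
  by apply/rowP => i; rewrite !mxE big_ord1 !mxE eqxx mulrC.
rewrite /slice_sum (bigD1 l) //= big1 ?addr0 => [|k /negPf ne_kl].
  by rewrite colE eqxx scale1r v2rK.
by rewrite colE ne_kl scale0r !linear0.
Qed.

End MatrixMaps.

HB.instance Definition _ (F : fieldType) (U1 U2 U3 V1 V2 V3 : vectType F)
    (A1 : 'Hom(U1, V1)) (A2 : 'Hom(U2, V2)) (A3 : 'Hom(U3, V3)) :=
  GRing.isLinear.Build F (tensor U1 U2 U3) (tensor V1 V2 V3) _
    (tensor_map A1 A2 A3) (tensor_map_linear A1 A2 A3).

Section Restriction.

Variables (F : fieldType) (U1 U2 U3 V1 V2 V3 : vectType F).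

(** Each copy of T in the Kronecker product with <1,1,p> lives on its own
    summand of U2 (x) F^p and U3 (x) F^p, so the maps glued from the [B2 l] and
    the [B3 l] act on the l-th copy as [B2 l] and [B3 l], without cross terms. *)
Lemma restricts_blacksquare_sum p (T : tensor U1 U2 U3) (A1 : 'Hom(U1, V1))
    (B2 : 'I_p -> 'Hom(U2, V2)) (B3 : 'I_p -> 'Hom(U3, V3)) :
  restricts (blacksquare p T) (\sum_l tensor_map A1 (B2 l) (B3 l) T).
Proof.
exists A1, (linfun (slice_sum B2)), (linfun (slice_sum B3)).
under eq_bigr => l _ do
  rewrite [T in tensor_map _ _ _ T]tensor_sum_pure linear_sum.
rewrite linear_sum exchange_big; apply: eq_bigr => i _ /=.
rewrite linear_sum; apply: eq_bigr => l _ /=.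
by rewrite !linearZ /= !tensor_map_pure !lfunE /= !slice_sum_tens_vec.
Qed.

(** The entrywise form of the previous lemma, in which [S] can be compared with
    coefficients and values of polynomials. *)
Lemma restricts_blacksquare p (T : tensor U1 U2 U3) (S : tensor V1 V2 V3)
    (A1 : 'Hom(U1, V1)) (M2 : 'I_p -> 'M[F]_(dim U2, dim V2))
    (M3 : 'I_p -> 'M[F]_(dim U3, dim V3)) :
    (forall j, S j = \sum_l \sum_i coord_mx A1 i.1.1 j.1.1 *
       M2 l i.1.2 j.1.2 * M3 l i.2 j.2 * T i) ->
  restricts (blacksquare p T) S.
Proof.
move=> defS.
suff -> : S = \sum_l tensor_map A1 (mx_hom (M2 l)) (mx_hom (M3 l)) T.
  exact: restricts_blacksquare_sum.
apply/ffunP => j; rewrite defS sum_ffunE; apply: eq_bigr => l _.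
by rewrite ffunE !coord_mx_hom.
Qed.

(** Dividing the right-hand side of a degeneration by eps^d: its entries are
    eps^d g with g a polynomial with e + 1 coefficients, whose constant term is
    the entry of [S].  Both restrictions are ways to compute this constant
    term from the left-hand side. *)
Lemma partially_degeneratesP d e (T : tensor U1 U2 U3) (S : tensor V1 V2 V3) :
  partially_degenerates d e T S ->
  exists (A1 : 'Hom(U1, V1)) (A2 : 'M[{poly F}]_(dim U2, dim V2))
         (A3 : 'M[{poly F}]_(dim U3, dim V3)),
    forall j, exists g : {poly F},
      [/\ (size g <= e.+1)%N, g`_0 = S j &
        \sum_i (coord_mx A1 i.1.1 j.1.1)%:P * A2 i.1.2 j.1.2 * A3 i.2 j.2 *
          (T i)%:P = g * 'X^d].
Proof.
move=> [A1 [A2 [A3 [E eqE]]]]; exists A1, A2, A3 => j.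
(* h collects the error terms S_1 + S_2 eps + ..., so that g = S + h eps. *)
pose h : {poly F} := \sum_(k < e) E k j *: 'X^k.
exists ((S j)%:P + h * 'X); split.
- apply: leq_trans (size_polyD _ _) _; rewrite geq_max.
  rewrite (leq_trans (size_polyC_leq1 _)) //=.
  have [-> | h0] := eqVneq h 0; first by rewrite mul0r size_poly0.
  rewrite size_mulX // ltnS; apply: leq_trans (size_sum _ _ _) _.
  apply/bigmax_leqP => k _.
  by apply: leq_trans (size_scale_leq _ _) _; rewrite size_polyXn.
- by rewrite coefD coefC coefMX addr0.
- move/ffunP/(_ j): eqE; rewrite !ffunE sum_ffunE.
  under eq_bigr => i _ do rewrite mxE ffunE expr0 alg_polyC.
  move=> ->; rewrite mulrDl mul_polyC; congr (_ + _).
  rewrite -mulrA -exprS mulr_suml; apply: eq_bigr => k _.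
  by rewrite ffunE -scalerAl -exprD addnS addnC addnS.
Qed.

(** The constant term of g is the coefficient of eps^d in eps^d g, hence a
    convolution with d + 1 terms of the coefficients of A2 and A3. *)
Lemma restricts_approximation d e (T : tensor U1 U2 U3)
    (S : tensor V1 V2 V3) :
  partially_degenerates d e T S -> restricts (blacksquare d.+1 T) S.
Proof.
move=> /partially_degeneratesP[A1 [A2 [A3 expand]]].
apply: (@restricts_blacksquare _ _ _ A1 (fun l => \matrix_(i, j) (A2 i j)`_l)
          (fun l => \matrix_(i, j) (A3 i j)`_(d - l))) => j.
have [g [_ <- /(congr1 (coefp d))]] := expand j.
rewrite /= coefMXn ltnn subnn => <-.
rewrite coef_sum exchange_big; apply: eq_bigr => i _ /=.
rewrite coefMC -mulrA coefCM coefM mulr_sumr mulr_suml.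
by apply: eq_bigr => l _; rewrite !mxE mulrA.
Qed.

(** The constant term of g is interpolated from the values of g at
    x 0, ..., x e; as these are nonzero, the factor eps^d can be divided out
    there. *)
Lemma restricts_error (x : nat -> F) d e (T : tensor U1 U2 U3)
    (S : tensor V1 V2 V3) :
    injective x -> (forall n, x n != 0) ->
  partially_degenerates d e T S -> restricts (blacksquare e.+1 T) S.
Proof.
move=> x_inj x_neq0 /partially_degeneratesP[A1 [A2 [A3 expand]]].
(* The Lagrange weight for evaluation at 0, corrected by the factor eps^d. *)
pose c (l : 'I_e.+1) := (tnth (lagrange e.+1 x) l)`_0 / x l ^+ d.
apply: (@restricts_blacksquare _ _ _ A1
  (fun l => c l *: map_mx (horner_eval (x l)) A2)
  (fun l => map_mx (horner_eval (x l)) A3)) => j.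
have [g [size_g <- eq_g]] := expand j.
rewrite {1}(lagrange_gen _ x_inj size_g) // coef_sum.
apply: eq_bigr => l _; rewrite coefCM.
have -> : g.[x l] = (g * 'X^d).[x l] / x l ^+ d.
  by rewrite hornerM hornerXn mulfK ?expf_neq0.
rewrite [LHS]mulrAC -[LHS]mulrA -/(c l) [LHS]mulrC -eq_g horner_sum mulr_sumr.
apply: eq_bigr => i _; rewrite !hornerM !hornerC !mxE /horner_eval.
(* With its body, the quotient c l would itself be reassociated by mulrA. *)
by clearbody c; rewrite !mulrA; congr (_ * _ * _ * _); exact: mulrC.
Qed.

End Restriction.

Theorem proposition4p5 (R : realType) (U1 U2 U3 V1 V2 V3 : vectType R[i])
    (T : tensor U1 U2 U3) (S : tensor V1 V2 V3) (d e : nat)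
    (hTS : partially_degenerates d e T S) :
  restricts (blacksquare d.+1 T) S /\ restricts (blacksquare e.+1 T) S.
Proof.
split; first exact: restricts_approximation hTS.
(* In characteristic 0, the points 1, 2, 3, ... are distinct and nonzero. *)
apply: (@restricts_error _ _ _ _ _ _ _ (fun n => n.+1%:R) _ _ _ _ _ _ hTS).
  by move=> m n /eqP; rewrite eqr_nat => /eqP[].
by move=> n; rewrite pnatr_eq0.
Qed.
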